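(* Let $(\mathcal{S},d)$ be a nonempty finite metric space, $k\ge 1$ an integer, $\mathcal{U}=\{1,\ldots,k\}$, and $p:\mathcal{S}\to[0,1]$ a probability mass function. Consider the stochastic $k$-server problem on $(\mathcal{S},d)$ with request distribution $p$, with state space $\mathcal{X}=\mathcal{S}^{k+1}$. Let $m^*=(m_1^*,\ldots,m_k^* )\in\mathcal{S}^k$ minimize $$\sum_{s\in\mathcal{S}}p(s)\min_{i\in\mathcal{U}}d(m_i,s)$$ over $m\in\mathcal{S}^k$. Let $\mathcal{S}_1,\ldots,\mathcal{S}_k$ be disjoint (possibly empty) sets with union $\mathcal{S}$ such that every $s\in\mathcal{S}_i$ satisfies $d(m_i^*,s)\le d(m_j^*,s)$ for all $j=1,\ldots,k$. Let $\mu_d$ be the decentralized policy given by $\mu_d(\widehat{x},x_1,\ldots,x_k)=i$ if $\widehat{x}\in\mathcal{S}_i$. Let $\mu_*$ be an optimal static state-feedback policy. Then $$J(\mu_d,x(0))\le 2\,J(\mu_*,x(0))\qquad\text{for all } x(0)\in\mathcal{X}.$$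
   Context: Stochastic $k$-server problem: at each time $t\in\{0,1,2,\ldots\}$ the state is $x(t)=(\widehat{x}(t),x_1(t),\ldots,x_k(t))\in\mathcal{X}=\mathcal{S}^{k+1}$, where $\widehat{x}(t)$ is the location of the current service request and $x_i(t)$ is the location of server $i$. An action $u(t)\in\mathcal{U}=\{1,\ldots,k\}$ (the index of the server dispatched) is chosen, and the cost $r(x(t),u(t))=d(x_{u(t)}(t),\widehat{x}(t))$ is incurred. Then $x_{u(t)}(t+1)=\widehat{x}(t)$, $x_i(t+1)=x_i(t)$ for $i\ne u(t)$, and the next request $\widehat{x}(t+1)$ is drawn from $p$, independently of everything up to time $t$. A static state-feedback policy is a function $\mu:\mathcal{X}\to\mathcal{U}$; under it $u(t)=\mu(x(t))$, so the state evolves as a finite Markov chain $X(t)$. Its average per-period cost from initial state $x(0)$ is $$J(\mu,x(0))=\lim_{t\to\infty}\frac{1}{t+1}\sum_{\tau=0}^{t}E\big[r(X(\tau),\mu(X(\tau)))\,\big|\,X(0)=x(0)\big].$$ An optimal policy $\mu_*$ is a static state-feedback policy which minimizes $J(\mu,x(0))$ over all static state-feedback policies $\mu$, for every $x(0)\in\mathcal{X}$. *)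

(* Defs.v *)
From HB Require Import structures.
From mathcomp Require Import all_boot all_order all_algebra.
From mathcomp Require Import all_classical all_reals all_analysis.

Set Implicit Arguments.
Unset Strict Implicit.
Unset Printing Implicit Defensive.

Import Order.TTheory GRing.Theory Num.Theory.

Local Open Scope classical_set_scope.
Local Open Scope ring_scope.

#[short(type="finMetricType")]
HB.structure Definition FinMetric (K : numDomainType) :=
  {M of Metric K M & Finite M}.

Definition is_pmf (R : realType) (S : finType) (p : S -> R) : Prop :=
  (forall s, 0 <= p s <= 1) /\ \sum_(s : S) p s = 1.

(* [(xh, x)]: [xh] is the location of the current request and [x i] the location
   of server [i]; servers are numbered from 0. *)
Definition state (S : finType) (k : nat) : Type := (S * {ffun 'I_k -> S})%type.

Definition policy (S : finType) (k : nat) : Type := state S k -> 'I_k.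

Definition cost (R : realType) (S : finMetricType R) (k : nat)
    (x : state S k) (u : 'I_k) : R :=
  mdist (x.2 u) x.1.

Definition next (S : finType) (k : nat) (x : state S k) (u : 'I_k) (s : S) :
    state S k :=
  (s, [ffun i => if i == u then x.1 else x.2 i]).

(* [w t] is the request revealed at time [t.+1]; the request of time 0 is part
   of the deterministic initial state [x0]. *)
Fixpoint trajectory (Omega : Type) (S : finType) (k : nat)
    (w : nat -> Omega -> S) (mu : policy S k) (x0 : state S k)
    (t : nat) (omega : Omega) : state S k :=
  match t with
  | 0%N => x0
  | t'.+1 => let x := trajectory w mu x0 t' omega in
             next x (mu x) (w t' omega)
  end.

Record iid_requests (dsp : measure_display) (Omega : measurableType dsp)
    (R : realType) (P : probability Omega R) (S : finType) (p : S -> R)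
    (w : nat -> Omega -> S) : Prop := IidRequests {
  iid_measurable : forall t (B : set S), measurable (w t @^-1` B);
  iid_law : forall t s, P (w t @^-1` [set s]) = (p s)%:E;
  iid_independent : forall (I : seq nat) (B : nat -> set S), uniq I ->
    P (\bigcap_(t in [set` I]) (w t @^-1` B t)) =
    (\prod_(t <- I) P (w t @^-1` B t))%E
}.

(* Conditioning on [X(0) = x0] is rendered by starting the chain at [x0]. *)
Definition average_cost (dsp : measure_display) (Omega : measurableType dsp)
    (R : realType) (P : probability Omega R) (S : finMetricType R) (k : nat)
    (w : nat -> Omega -> S) (mu : policy S k) (x0 : state S k) : \bar R :=
  limn (fun t => ((t.+1%:R)^-1)%:E *
    \sum_(0 <= tau < t.+1)
      'E_P[fun omega => let x := trajectory w mu x0 tau omega in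
                        cost x (mu x)])%E.

Definition is_optimal (dsp : measure_display) (Omega : measurableType dsp)
    (R : realType) (P : probability Omega R) (S : finMetricType R) (k : nat)
    (w : nat -> Omega -> S) (mu : policy S k) : Prop :=
  forall (mu' : policy S k) (x0 : state S k),
    (average_cost P w mu x0 <= average_cost P w mu' x0)%E.

(* The default value of the iterated minimum is the distance to server 0, so
   that it is the minimum over the (nonempty) set of servers. *)
Definition median_cost (R : realType) (S : finMetricType R) (p : S -> R)
    (k : nat) (k_gt0 : (0 < k)%N) (m : {ffun 'I_k -> S}) : R :=
  \sum_(s : S) p s *
    \big[Num.min/mdist (m (Ordinal k_gt0)) s]_(i < k) mdist (m i) s.

Definition is_median (R : realType) (S : finMetricType R) (p : S -> R)
    (k : nat) (k_gt0 : (0 < k)%N) (m : {ffun 'I_k -> S}) : Prop :=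
  forall m' : {ffun 'I_k -> S}, median_cost p k_gt0 m <= median_cost p k_gt0 m'.

(* Main.v *)
Require Import Defs.
From HB Require Import structures.
From mathcomp Require Import all_boot all_order all_algebra.
From mathcomp Require Import all_classical all_reals all_analysis.
From mathcomp Require Import measurable_realfun ring lra.

(* For any policy, the request served at time [t.+1] is independent of the
   server positions, so that the expected cost is at least the median cost
   [med]. For the decentralized policy, the sum of the distances from the
   servers to their medians is a potential: serving a request [s] with the
   server of median [m] costs at most the decrease of the potential plus
   [2 d(m, s)], and [d(m, s)] has mean [med]; telescoping bounds the average
   cost by [2 med]. The limits defining both average costs exist by the mean
   ergodic theorem for the transition operator of the chain. *)

Set Implicit Arguments.
Unset Strict Implicit.
Unset Printing Implicit Defensive.

Import Order.TTheory GRing.Theory Num.Theory.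
Import numFieldNormedType.Exports.

Local Open Scope classical_set_scope.
Local Open Scope ring_scope.

(** * Mean ergodic theorem in finite dimension *)

Lemma cvg0_div_bounded (R : realType) (u : nat -> R) (C : R) :
  (forall n, `|u n| <= C) -> (fun n => n.+1%:R^-1 * u n) @ \oo --> 0.
Proof.
move=> uC.
have C0 : (fun n => C * n.+1%:R^-1) @ \oo --> (0 : R).
  by rewrite -[0](mulr0 C); apply: cvgMr; exact: cvg_harmonic.
apply/cvgr0Pnorm_le => e e0.
move/cvgr0Pnorm_le : C0 => /(_ _ e0); apply: filterS => n; apply: le_trans.
rewrite mulrC !normrM ler_wpM2r//.
exact: le_trans (uC n) (ler_norm _).
Qed.

Lemma bounded_multiples_eq0 (R : archiRealFieldType) (a C : R) :
  (forall n, `|a *+ n| <= C) -> a = 0.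
Proof.
move=> aC; apply/eqP; apply: contraT => a0.
have {}a0 : 0 < `|a| by rewrite normr_gt0.
have := aC (Num.bound (C / `|a|)); apply: contraTT => _.
rewrite normrMn -ltNge -mulr_natl -ltr_pdivrMr//.
by rewrite archi_boundP// divr_ge0// (le_trans _ (aC 0%N)).
Qed.

Lemma iter_linear (K : nzRingType) (V : lmodType K) (T : {linear V -> V})
    (n : nat) (a : K) (u v : V) :
  iter n T (a *: u + v) = a *: iter n T u + iter n T v.
Proof. by elim: n => //= n ->; rewrite linearP. Qed.

(** When the iterates of [T] are bounded, this telescoping makes the averages tend to 0 on the image
    of [1 - T]. *)
Lemma sum_iter_coboundary (K : nzRingType) (V : lmodType K)
    (T : {linear V -> V}) (n : nat) (u : V) :
  \sum_(0 <= t < n) iter t T (u - T u) = u - iter n T u.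
Proof.
rewrite (eq_bigr (fun t => - (iter t.+1 T u - iter t T u))).
  by rewrite sumrN telescope_sumr// opprB.
move=> t _.
by rewrite opprB -scaleN1r [u + _]addrC iter_linear scaleN1r iterSr addrC.
Qed.

(* If [v = u - T u] is fixed by [T], then [n v = u - T^n u] for all [n], so
   that [v = 0] by boundedness; by the rank theorem the kernel and the image of
   [1 - T] therefore span the space, and the averages converge on both. *)
Lemma mean_ergodic (R : realType) (X : finType)
    (T : {linear {ffun X -> R^o} -> {ffun X -> R^o}})
    (T_bounded : forall f, exists C : R, forall n x, `|iter n T f x| <= C)
    (f : {ffun X -> R^o}) (x : X) :
  cvgn (fun n => n.+1%:R^-1 * \sum_(0 <= t < n.+1) (iter t T f x : R)).
Proof.
pose D : 'End({ffun X -> R^o}) := (\1 - linfun T)%VF.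
have DE u : D u = u - T u by rewrite add_lfunE opp_lfunE id_lfunE lfunE.
have sumD n u y : \sum_(0 <= t < n) (iter t T (D u) y : R) = u y - iter n T u y.
  have := sum_iter_coboundary T n u; rewrite DE.
  move=> /(congr1 (fun g : {ffun X -> R^o} => g y)).
  by rewrite sum_ffunE !ffunE.
have fixE v : v \in lker D -> forall n, iter n T v = v.
  rewrite memv_ker DE subr_eq0 => /eqP vE; elim=> //= n ->; exact/esym.
have bounded (u : {ffun X -> R^o}) :
    exists C : R, forall n y, `|u y - iter n T u y| <= C.
  have [C uC] := T_bounded u; exists (C + C) => n y.
  exact: le_trans (ler_normB _ _) (lerD (uC 0 y) (uC n y)).
have cvg_im u : (fun n => n.+1%:R^-1 *
      \sum_(0 <= t < n.+1) (iter t T (D u) x : R))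
    @ \oo --> 0.
  have [C uC] := bounded u.
  by apply: (@cvg0_div_bounded _ _ C) => n; rewrite sumD.
have cap0 : (lker D :&: limg D)%VS = 0%VS.
  apply/eqP; rewrite -subv0; apply/subvP => v; rewrite memv_cap => /andP[vk].
  move=> /memv_imgP[u _ vE]; rewrite memv0; apply/eqP/ffunP => y; rewrite ffunE.
  have [C uC] := bounded u; apply: (@bounded_multiples_eq0 _ _ C) => n.
  apply: le_trans (uC n y); rewrite -sumD -vE.
  under eq_bigr do rewrite fixE//.
  by rewrite sumr_const_nat subn0.
have full : (lker D + limg D)%VS = fullv.
  apply/eqP; rewrite -dimv_leqif_eq ?subvf// dimv_disjoint_sum//.
  by rewrite -(limg_ker_dim D fullv) capfv.
have /memv_addP[v vk [_ /memv_imgP[u _ ->] fE]] : f \in (lker D + limg D)%VS.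
  by rewrite full memvf.
apply/cvg_ex; exists (v x : R); rewrite /= -[X in _ --> X]addr0.
rewrite [X in X @ _ --> _](_ : _ = (fun n => v x +
    n.+1%:R^-1 * \sum_(0 <= t < n.+1) (iter t T (D u) x : R))).
  by apply: cvgD (cvg_im u); exact: cvg_cst.
apply/funext => n; rewrite fE.
have -> : \sum_(0 <= t < n.+1) (iter t T (v + D u) x : R) =
    n.+1%:R * v x + \sum_(0 <= t < n.+1) (iter t T (D u) x : R).
  rewrite mulr_natl -[in X in _ *+ X](subn0 n.+1) -sumr_const_nat -big_split/=.
  apply: eq_bigr => t _.
  by rewrite -[v in LHS]scale1r iter_linear scale1r ffunE fixE.
by rewrite mulrDr mulKf// pnatr_eq0.
Qed.

(** * Transition operator of the chain under a policy *)

Definition transition (R : realType) (S : finType) (k : nat) (p : S -> R)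
    (mu : policy S k) (f : state S k -> R) (x : state S k) : R :=
  \sum_(s : S) p s * f (Defs.next x (mu x) s).

(** A copy of [transition] on a finite-dimensional vector space, where [mean_ergodic] applies. *)
Definition transition_ffun (R : realType) (S : finType) (k : nat) (p : S -> R)
    (mu : policy S k) (f : {ffun state S k -> R^o}) : {ffun state S k -> R^o} :=
  [ffun x => transition p mu f x].

Lemma transition_ffun_linear (R : realType) (S : finType) (k : nat)
    (p : S -> R) (mu : policy S k) : linear (transition_ffun p mu).
Proof.
move=> a f g; apply/ffunP => x.
rewrite /transition_ffun /transition !ffunE/=.
rewrite -[RHS]/(a * _ + _) mulr_sumr -big_split/=.
by apply: eq_bigr => s _; rewrite !ffunE mulrDr mulrCA.
Qed.

HB.instance Definition _ (R : realType) (S : finType) (k : nat) (p : S -> R)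
    (mu : policy S k) :=
  GRing.isLinear.Build R {ffun state S k -> R^o} {ffun state S k -> R^o} _
    (transition_ffun p mu) (transition_ffun_linear p mu).

Section Transition.
Variables (R : realType) (S : finType) (k : nat) (p : S -> R).
Variables (mu : policy S k).
Hypothesis p_pmf : is_pmf p.
Notation T := (transition p mu).
Implicit Types (f g : state S k -> R) (x : state S k).

Lemma iter_transition_cst n (C : R) x : iter n T (fun=> C) x = C.
Proof.
elim: n x => //= n IHn x; rewrite /transition.
by under eq_bigr do rewrite IHn; rewrite -mulr_suml p_pmf.2 mul1r.
Qed.

Lemma ler_iter_transition n f g x :
  (forall y, f y <= g y) -> iter n T f x <= iter n T g x.
Proof.
move=> fg; elim: n x => //= n IHn x.
by apply: ler_sum => s _; rewrite ler_wpM2l// (andP (p_pmf.1 s)).1.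
Qed.

Lemma iter_transition_linear n (a : R) f g x :
  iter n T (fun y => a * f y + g y) x = a * iter n T f x + iter n T g x.
Proof.
elim: n x => //= n IHn x; rewrite /transition mulr_sumr -big_split/=.
by apply: eq_bigr => s _; rewrite IHn mulrDr mulrCA.
Qed.

(** The iterates on indicators are the [n]-step transition probabilities from [x] to [y]. *)
Lemma iter_transition_indic n f x :
  iter n T f x = \sum_y f y * iter n T (fun z => (z == y)%:R) x.
Proof.
elim: n x => [|n IHn] x /=.
  rewrite (bigD1 x)//= eqxx mulr1 big1 ?addr0// => y yx.
  by rewrite eq_sym (negbTE yx) mulr0.
rewrite /transition; under [RHS]eq_bigr do rewrite mulr_sumr.
rewrite exchange_big/=; apply: eq_bigr => s _; rewrite IHn mulr_sumr.
by apply: eq_bigr => y _; rewrite mulrCA.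
Qed.

Lemma cvg_mean_transition f x :
  cvgn (fun n => n.+1%:R^-1 * \sum_(0 <= t < n.+1) iter t T f x).
Proof.
pose L := transition_ffun p mu.
have iterE (u : {ffun state S k -> R^o}) n y : iter n L u y = iter n T u y.
  elim: n y => //= n IHn y; rewrite ffunE.
  by apply: eq_bigr => s _; rewrite IHn.
have bounded (u : {ffun state S k -> R^o}) :
    exists C : R, forall n y, `|iter n L u y| <= C.
  (* Any bound on [|u|] would do: the operator is monotone and fixes constants, so the iterates obey
     the same bound. *)
  exists (\sum_z `|(u z : R)|) => n y; rewrite iterE.
  have le_sum z : `|(u z : R)| <= \sum_z `|(u z : R)|.
    by rewrite (bigD1 z)//= lerDl sumr_ge0.
  rewrite ler_norml -[X in - X](iter_transition_cst n _ y).
  apply/andP; split.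
    (* Adding the constant 0 gives the lower bound the shape [a * f + g] of
       [iter_transition_linear]. *)
    rewrite -[leLHS]addr0 -[X in _ + X](iter_transition_cst n 0 y) -mulN1r.
    rewrite -iter_transition_linear; apply: ler_iter_transition => z.
    by rewrite addr0 mulN1r; have := le_sum z; rewrite ler_norml => /andP[].
  rewrite -[leRHS](iter_transition_cst n _ y).
  by apply: ler_iter_transition => z; exact: le_trans (ler_norm _) (le_sum z).
have E t : iter t L [ffun y => f y] x = iter t T f x.
  by rewrite iterE; congr (iter t T _ x); apply/funext => y; rewrite ffunE.
have := @mean_ergodic _ _ _ bounded [ffun y => f y] x.
by under eq_fun do under eq_bigr do rewrite E.
Qed.

End Transition.

(** * Random variables with finitely many values *)

Section FiniteValued.
Variables (dsp : measure_display) (Omega : measurableType dsp).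

(** Measurability for the discrete sigma-algebra on [X], in the form of [iid_measurable]. *)
Definition fin_measurable (X : Type) (F : Omega -> X) :=
  forall B : set X, measurable (F @^-1` B).

Lemma fin_measurable_pair (X Y : finType) (F : Omega -> X) (G : Omega -> Y) :
  fin_measurable F -> fin_measurable G ->
  fin_measurable (fun om => (F om, G om)).
Proof.
move=> mF mG B.
rewrite [X in measurable X](_ : _ = \bigcup_(z in B)
    ((F @^-1` [set z.1]) `&` (G @^-1` [set z.2]))).
  apply: fin_bigcup_measurable => [|z _]; first exact: finite_finset.
  exact: measurableI.
apply/seteqP; split=> [om Bo|om [[a b] Bab [/= -> ->]]//].
by exists (F om, G om).
Qed.

Lemma fin_measurable_comp (X Y : Type) (f : X -> Y) (F : Omega -> X) :
  fin_measurable F -> fin_measurable (f \o F).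
Proof. by move=> mF B; exact: mF (f @^-1` B). Qed.

Lemma measure_fin_partition (R : realType) (P : {measure set Omega -> \bar R})
    (X : finType) (F : Omega -> X) (A : set Omega) :
  fin_measurable F -> measurable A ->
  P A = (\sum_(x : X) P (A `&` F @^-1` [set x]))%E.
Proof.
move=> mF mA.
rewrite [in LHS](_ : A = \bigcup_(x in [set` index_enum X])
    (A `&` F @^-1` [set x])); last first.
  apply/seteqP; split=> [om Ao|om [x _ []]//].
  by exists (F om); rewrite /= ?mem_index_enum.
rewrite measure_fin_bigcup//.
- by rewrite -fsbig_seq ?index_enum_uniq.
- by move=> x y _ _ [om [[_ <-] [_ <-]]].
- by move=> x _; exact: measurableI.
Qed.

(** Integrate the decomposition of [g \o F] into indicators of its cells; nonnegativity allows
    exchanging sum and integral without an integrability argument. *)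
Lemma expectation_fin (R : realType) (P : probability Omega R) (X : finType)
    (F : Omega -> X) (g : X -> R) :
  fin_measurable F -> (forall x, 0 <= g x) ->
  ('E_P[g \o F] = \sum_(x : X) (g x)%:E * P (F @^-1` [set x]))%E.
Proof.
move=> mF g0; rewrite unlock.
under eq_integral => om _.
  have -> : ((g \o F) om)%:E =
      (\sum_(x : X) (g x)%:E * (\1_(F @^-1` [set x]) om)%:E)%E.
    rewrite (bigD1 (F om))//= indicE mem_set//= mule1 big1 ?adde0// => x xF.
    by rewrite indicE memNset ?mule0// => /= /esym/eqP; rewrite (negbTE xF).
  over.
rewrite ge0_integral_sum//=.
- apply: eq_bigr => x _; rewrite ge0_integralZl//=.
  + by rewrite integral_indic// setIT.
  + exact/measurable_EFinP/measurable_indic.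
  + by rewrite lee_fin.
- move=> x; apply: measurable_funeM.
  exact/measurable_EFinP/measurable_indic.
- by move=> x om _; rewrite mule_ge0// lee_fin.
Qed.

End FiniteValued.

(** * Law of the trajectory *)

Section Law.
Variables (dsp : measure_display) (Omega : measurableType dsp) (R : realType).
Variables (P : probability Omega R) (S : finType) (k : nat) (p : S -> R).
Variables (w : nat -> Omega -> S) (mu : policy S k) (x0 : state S k).
Hypothesis w_iid : iid_requests P p w.
Notation X := (trajectory w mu x0).
Notation T := (transition p mu).

Lemma fin_measurable_trajectory t : fin_measurable (X t).
Proof.
elim: t => [|t IHt] /=.
  move=> B; rewrite preimage_cst; case: ifP => _.
    exact: measurableT.
  exact: measurable0.
have := fin_measurable_pair IHt (iid_measurable w_iid t).
exact: (fin_measurable_comp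
  (fun z : state S k * S => Defs.next z.1 (mu z.1) z.2)).
Qed.

Definition requests_from (I : seq nat) (h : nat -> S) : set Omega :=
  \bigcap_(i in [set` I]) (w i @^-1` [set h i]).

Lemma measurable_requests_from I h : measurable (requests_from I h).
Proof.
apply: fin_bigcap_measurable => [|i _]; first exact: finite_seq.
exact: iid_measurable w_iid i _.
Qed.

(* The later requests are part of the event so that the induction on [t] can
   split on the value of [w t] by means of its own hypothesis. *)
Lemma probability_trajectory_requests t x (I : seq nat) (h : nat -> S) :
  uniq I -> all (leq t) I ->
  P (X t @^-1` [set x] `&` requests_from I h) =
  (iter t T (fun y => (y == x)%:R) x0 * \prod_(i <- I) p (h i))%:E.
Proof.
elim: t x I h => [|t IHt] x I h uI tI /=.
  (* The initial state is deterministic, so its event is everything or empty. *)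
  rewrite preimage_cst; case: ifPn => x0x.
    rewrite setTI (iid_independent w_iid)//.
    move: x0x; rewrite inE => ->; rewrite eqxx mul1r -prodEFin.
    by apply: eq_bigr => i _; exact: iid_law w_iid _ _.
  move: x0x; rewrite notin_setE /= => /eqP/negbTE ->.
  by rewrite set0I measure0 mul0r.
have tNI : t \notin I by apply/negP => /(allP tI); rewrite ltnn.
(* The last transition is split off: [y] will be the state at time [t]. *)
rewrite -iterS iterSr iter_transition_indic mulr_suml -sumEFin.
rewrite (measure_fin_partition P
  (fin_measurable_pair (fin_measurable_trajectory t)
    (iid_measurable w_iid t))); last first.
  apply: measurableI; last exact: measurable_requests_from.
  exact: (fin_measurable_trajectory t.+1).
rewrite (eq_bigr (fun z : state S k * S =>
    ((Defs.next z.1 (mu z.1) z.2 == x)%:R *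
     (iter t T (fun y => (y == z.1)%:R) x0 *
      (p z.2 * \prod_(i <- I) p (h i))))%:E)).
  rewrite -(pair_bigA _ (fun y s => ((Defs.next y (mu y) s == x)%:R *
     (iter t T (fun y0 => (y0 == y)%:R) x0 *
      (p s * \prod_(i <- I) p (h i))))%:E))/=.
  apply: eq_bigr => y _; rewrite sumEFin /transition; congr EFin.
  rewrite !mulr_suml; apply: eq_bigr => s _.
  ring.
move=> [y s] _ /=.
(* All times in [I] exceed [t], so the event [w t = s] can join the prescribed requests. *)
pose h' i := if i == t then s else h i.
have req_h' : w t @^-1` [set s] `&` requests_from I h =
    requests_from (t :: I) h'.
  apply/seteqP; split=> [om [wt reqI] i|om req].
    rewrite /= inE /h'; case: eqP => [->//|_ /=]; exact: reqI.
  split=> [|i /= iI].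
    by have := req t; rewrite /= mem_head /h' eqxx; exact.
  have := req i; rewrite /= inE iI orbT /h'; case: eqP => [it|_]; last exact.
  by rewrite it (negbTE tNI) in iI.
have prod_h' : \prod_(i <- t :: I) p (h' i) = p s * \prod_(i <- I) p (h i).
  rewrite big_cons /h' eqxx; congr (_ * _); apply: eq_big_seq => i iI.
  by case: eqP => // it; rewrite it (negbTE tNI) in iI.
(* If [y] and [s] lead to [x], the cell is an event of the induction hypothesis; otherwise it is
   empty. *)
rewrite -prod_h'; case: eqP => [yx|yx].
  rewrite mul1r -IHt/= ?tNI ?leqnn//; last first.
    by apply: sub_all tI => i; exact: ltnW.
  congr (P _); rewrite -req_h'; apply/seteqP; split=> om /=.
    by move=> [[_ ?] [-> ->]].
  by move=> [Xy [ws ?]]; rewrite Xy ws.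
rewrite mul0r [X in P X](_ : _ = set0) ?measure0//.
by apply/seteqP; split=> om //= [[+ _] [Xy ws]]; rewrite Xy ws.
Qed.

Lemma expectation_trajectory t (g : state S k -> R) : (forall x, 0 <= g x) ->
  ('E_P[fun om => g (X t om)] = (iter t T g x0)%:E)%E.
Proof.
move=> g0; rewrite -[X in expectation _ X]/(g \o X t).
rewrite (expectation_fin _ (@fin_measurable_trajectory t))//.
rewrite iter_transition_indic -sumEFin; apply: eq_bigr => x _.
(* With no later request prescribed, only the law of [X t] remains; [fun=> x0.1] is a dummy. *)
have := @probability_trajectory_requests t x [::] (fun=> x0.1) isT isT.
rewrite (_ : requests_from [::] _ = setT); last by apply/seteqP; split.
by rewrite setIT big_nil mulr1 => ->.
Qed.

End Law.

(** * Average costs as real limits *)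

Section AverageCost.
Variables (dsp : measure_display) (Omega : measurableType dsp) (R : realType).
Variables (P : probability Omega R) (S : finMetricType R) (k : nat).
Variables (p : S -> R) (w : nat -> Omega -> S).
Hypotheses (p_pmf : is_pmf p) (w_iid : iid_requests P p w).

Definition mean_cost (mu : policy S k) (x0 : state S k) (n : nat) : R :=
  n.+1%:R^-1 * \sum_(0 <= t < n.+1)
    iter t (transition p mu) (fun x => cost x (mu x)) x0.

Lemma average_costE (mu : policy S k) (x0 : state S k) :
  average_cost P w mu x0 = (limn (mean_cost mu x0))%:E.
Proof.
rewrite -EFin_lim; last exact: cvg_mean_transition.
congr (limn _); apply/funext => n /=; rewrite EFinM -sumEFin; congr (_ * _)%E.
apply: eq_bigr => t _.
rewrite -(expectation_trajectory _ _ w_iid)// => x; exact: mdist_ge0.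
Qed.

(** The factor is [n] although there are [n.+1] costs, because the request of time 0 is given rather
    than drawn. The missing [l] and the constant [C] vanish after division by [n.+1]. *)
Lemma le_limn_mean_cost (mu : policy S k) (x0 : state S k) (l C : R) :
  (forall n, n%:R * l <= C + \sum_(0 <= t < n.+1)
    iter t (transition p mu) (fun x => cost x (mu x)) x0) ->
  l <= limn (mean_cost mu x0).
Proof.
move=> lC.
have cvg_shift : (fun n => mean_cost mu x0 n + n.+1%:R^-1 * (C + l)) @ \oo -->
    limn (mean_cost mu x0).
  rewrite -[X in _ --> X]addr0; apply: cvgD; first exact: cvg_mean_transition.
  exact: (@cvg0_div_bounded _ _ `|C + l|).
apply: (cvgr_to_ge cvg_shift); apply: nearW => n.
rewrite -mulrDr mulrC ler_pdivlMr ?ltr0n// mulrC -natr1 mulrDl mul1r.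
by rewrite addrA lerD2r addrC.
Qed.

Lemma limn_mean_cost_le (mu : policy S k) (x0 : state S k) (l C : R) :
  (forall n, \sum_(0 <= t < n.+1)
    iter t (transition p mu) (fun x => cost x (mu x)) x0 <= C + n%:R * l) ->
  limn (mean_cost mu x0) <= l.
Proof.
move=> lC.
have cvg_shift : (fun n => mean_cost mu x0 n + n.+1%:R^-1 * (l - C)) @ \oo -->
    limn (mean_cost mu x0).
  rewrite -[X in _ --> X]addr0; apply: cvgD; first exact: cvg_mean_transition.
  exact: (@cvg0_div_bounded _ _ `|l - C|).
apply: (cvgr_to_le cvg_shift); apply: nearW => n.
rewrite -mulrDr mulrC ler_pdivrMr ?ltr0n// mulrC -natr1 mulrDl mul1r.
by have := lC n; lra.
Qed.

(** * Comparison with the median cost *)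

Section Median.
Variables (k_gt0 : (0 < k)%N) (m : {ffun 'I_k -> S}).
Hypothesis m_median : is_median p k_gt0 m.

(* A request is served from positions chosen before it was revealed. *)
Lemma median_cost_le_transition (mu : policy S k) (x : state S k) :
  median_cost p k_gt0 m <= transition p mu (fun y => cost y (mu y)) x.
Proof.
(* The positions after the move do not involve the new request, so [x.1] is a placeholder for it. *)
pose y := (Defs.next x (mu x) x.1).2.
apply: le_trans (m_median y) _; apply: ler_sum => s _.
by rewrite ler_wpM2l ?(andP (p_pmf.1 s)).1//; exact: bigmin_le.
Qed.

Lemma median_cost_le_average (mu : policy S k) (x0 : state S k) :
  median_cost p k_gt0 m <= limn (mean_cost mu x0).
Proof.
apply: (@le_limn_mean_cost _ _ _ 0) => n; rewrite add0r.
(* The cost of time 0 is only bounded below by 0. *)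
rewrite big_nat_recl//= -[leLHS]add0r lerD ?mdist_ge0//.
rewrite mulr_natl -[in leLHS](subn0 n) -sumr_const_nat; apply: ler_sum => t _.
rewrite -iterS iterSr -[leLHS](iter_transition_cst mu p_pmf t _ x0).
by apply: ler_iter_transition => // y; exact: median_cost_le_transition.
Qed.

Definition displacement (x : state S k) : R := \sum_i mdist (x.2 i) (m i).

Variable mu : policy S k.
Hypothesis mu_nearest :
  forall x j, mdist (m (mu x)) x.1 <= mdist (m j) x.1.

Definition request_distance (x : state S k) : R := mdist (m (mu x)) x.1.

(** The default value is itself one of the distances, so any [j] gives the same minimum. *)
Lemma bigmin_request_distance (x : state S k) (j : 'I_k) :
  \big[Num.min/mdist (m j) x.1]_(i < k) mdist (m i) x.1 = request_distance x.
Proof.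
apply/le_anti/andP; split; first exact: bigmin_le.
by apply: le_bigmin => *; exact: mu_nearest.
Qed.

(** Even if [mu] breaks ties by looking at the positions, the distance to the chosen median is the
    minimum, which depends on the request alone. *)
Lemma transition_request_distance x :
  transition p mu request_distance x = median_cost p k_gt0 m.
Proof.
apply: eq_bigr => s _; congr (_ * _).
by rewrite -(bigmin_request_distance _ (Ordinal k_gt0)).
Qed.

(** Only the dispatched server's term of the potential changes: it becomes [request_distance x],
    whatever request is drawn next. The triangle inequality through the median gives the second
    [request_distance x]. *)
Lemma cost_le_displacement x :
  cost x (mu x) <=
  displacement x - transition p mu displacement x + 2 * request_distance x.
Proof.
have -> : transition p mu displacement x =
    displacement x - mdist (x.2 (mu x)) (m (mu x)) + request_distance x.
  rewrite /transition; under eq_bigr => s _.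
    have -> : displacement (Defs.next x (mu x) s) =
        displacement x - mdist (x.2 (mu x)) (m (mu x)) + request_distance x.
      rewrite /displacement (bigD1 (mu x))//= [in RHS](bigD1 (mu x))//=.
      rewrite ffunE eqxx (metric_sym x.1).
      rewrite (eq_bigr (fun i => mdist (x.2 i) (m i))).
        by rewrite /request_distance; ring.
      by move=> i /negbTE im; rewrite ffunE im.
    over.
  by rewrite -mulr_suml p_pmf.2 mul1r.
have := metric_triangle (x.2 (mu x)) (m (mu x)) x.1.
rewrite /cost /request_distance; lra.
Qed.

Lemma average_le_median_cost (x0 : state S k) :
  limn (mean_cost mu x0) <= 2 * median_cost p k_gt0 m.
Proof.
(* The constant collects the initial potential and the request distance of time 0, whose request is
   not drawn from [p]. *)
apply: (@limn_mean_cost_le _ _ _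
  (displacement x0 + 2 * request_distance x0)) => n.
set d := fun t => iter t (transition p mu) displacement x0.
set r := fun t => iter t (transition p mu) request_distance x0.
have iter_cost t : iter t (transition p mu) (fun x => cost x (mu x)) x0 <=
    d t - d t.+1 + 2 * r t.
  have -> : d t - d t.+1 + 2 * r t = iter t (transition p mu) (fun x =>
      2 * request_distance x +
      (-1 * transition p mu displacement x + displacement x)) x0.
    by rewrite !iter_transition_linear /d /r iterSr; ring.
  apply: ler_iter_transition => // x.
  by have := cost_le_displacement x; lra.
have r_med t : r t.+1 = median_cost p k_gt0 m.
  rewrite /r iterSr -[RHS](iter_transition_cst mu p_pmf t _ x0).
  congr (iter t _ _ x0); apply/funext => x; exact: transition_request_distance.
apply: le_trans (ler_sum _ (fun t _ => iter_cost t)) _.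
rewrite big_split/= -mulr_sumr.
rewrite (eq_bigr (fun t => - (d t.+1 - d t)));
  last by move=> t _; rewrite opprB.
rewrite sumrN telescope_sumr// opprB.
rewrite [X in 2 * X]big_nat_recl//=; under eq_bigr do rewrite r_med.
rewrite sumr_const_nat subn0 mulrDr -[_ *+ n]mulr_natl mulrCA addrA lerD2r.
rewrite lerD2r gerBl /d -[leLHS](iter_transition_cst mu p_pmf n.+1 0 x0).
by apply: ler_iter_transition => // x; apply: sumr_ge0 => i _; exact: mdist_ge0.
Qed.

End Median.
End AverageCost.

(* The factor 2 bound for the decentralized policy *)
Local Close Scope classical_set_scope.
Theorem theorem1 (R : realType) (S : finMetricType R) (S_gt0 : (0 < #|S|)%N)
    (k : nat) (k_gt0 : (0 < k)%N)
    (p : S -> R) (p_pmf : is_pmf p)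
    (dsp : measure_display) (Omega : measurableType dsp)
    (P : probability Omega R) (w : nat -> Omega -> S)
    (w_iid : iid_requests P p w)
    (mstar : {ffun 'I_k -> S}) (mstar_median : is_median p k_gt0 mstar)
    (Sp : 'I_k -> {set S})
    (Sp_disjoint : forall i j : 'I_k, i != j -> [disjoint Sp i & Sp j])
    (Sp_cover : \bigcup_(i < k) Sp i = [set: S])
    (Sp_nearest : forall (i : 'I_k) (s : S), s \in Sp i ->
       forall j : 'I_k, mdist (mstar i) s <= mdist (mstar j) s)
    (mud : policy S k)
    (mud_decentralized : forall (x : state S k) (i : 'I_k),
       x.1 \in Sp i -> mud x = i)
    (mustar : policy S k) (mustar_optimal : is_optimal P w mustar) :
  forall x0 : state S k,
    (average_cost P w mud x0 <= 2%:E * average_cost P w mustar x0)%E.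
Proof.
move=> x0.
have mud_nearest (x : state S k) j :
    mdist (mstar (mud x)) x.1 <= mdist (mstar j) x.1.
  have: x.1 \in \bigcup_(i < k) Sp i by rewrite Sp_cover inE.
  case/bigcupP => i _ xi; rewrite (mud_decentralized _ _ xi).
  exact: Sp_nearest.
rewrite !(average_costE p_pmf w_iid) -EFinM lee_fin.
apply: le_trans (average_le_median_cost p_pmf k_gt0 mud_nearest x0) _.
by rewrite ler_pM2l//; exact: median_cost_le_average.
Qed.
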